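(* Let $k\geq 2$ and $q\geq 1$ be integers and let $\mathcal{A}=\{\boldsymbol{\alpha}_1,\dots,\boldsymbol{\alpha}_q\}$ be as in the context. For the type-$\mathcal{A}$ random walk on $\mathbb{Z}^k$, let $\overline{S}_{n,k}=\frac{1}{n}(X_1+\cdots+X_n)$. Then $$\lim_{n\to\infty}\overline{S}_{n,k}=\frac{1}{\zeta(k)}$$ almost surely, where $\zeta$ is the Riemann zeta function.
   Context: $\mathcal{A}=\{\boldsymbol{\alpha}_1,\dots,\boldsymbol{\alpha}_q\}$ is a finite set of vectors $\boldsymbol{\alpha}_t=(\alpha_{t,1},\dots,\alpha_{t,k})$ with $0<\alpha_{t,j}<1$ for all $j$ and $\alpha_{t,1}+\cdots+\alpha_{t,k}=1$. For $\boldsymbol{\alpha}=(\alpha_1,\dots,\alpha_k)$ of this form, a type-$\boldsymbol{\alpha}$ step $\mathbf{w}(\boldsymbol{\alpha})$ is a random vector equal to the $j$-th standard basis vector of $\mathbb{Z}^k$ with probability $\alpha_j$ ($1\le j\le k$). The type-$\mathcal{A}$ random walk is $\mathbf{p}_0=(0,\dots,0)$, $\mathbf{p}_i=\mathbf{p}_{i-1}+\mathbf{w}(\boldsymbol{\alpha}'_i)$ for $i\ge1$, where at each step a type $\boldsymbol{\alpha}'_i\in\mathcal{A}$ is chosen and the steps are independent. A lattice point $\mathbf{n}=(n_1,\dots,n_k)\in\mathbb{Z}^k$ is visible if there is no other lattice point on the straight segment joining it to the origin (equivalently $\gcd(n_1,\dots,n_k)=1$). $X_i=1$ if $\mathbf{p}_i$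 is visible and $X_i=0$ otherwise. *)

(* Defs.v *)
From HB Require Import structures.
From mathcomp Require Import all_boot all_order all_algebra.
From mathcomp Require Import all_classical all_reals all_analysis.
Set Implicit Arguments. Unset Strict Implicit. Unset Printing Implicit Defensive.
Import Order.TTheory GRing.Theory Num.Theory numFieldNormedType.Exports.
Local Open Scope classical_set_scope.
Local Open Scope ring_scope.

Definition zeta (R : realType) (s : nat) : R :=
  limn (series (fun m : nat => (((m.+1)%:R : R) ^+ s)^-1)).

Definition is_type_vector (R : realType) (k : nat) (alpha : 'I_k -> R) : Prop :=
  (forall j, 0 < alpha j < 1) /\ \sum_(j < k) alpha j = 1.

Definition mutually_independent_discrete d (T : measurableType d)
  (R : realType) (P : probability T R) (k : nat) (W : nat -> T -> 'I_k) : Prop :=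
  forall (I : seq nat) (v : nat -> 'I_k), uniq I ->
    P (\bigcap_(i in [set i | i \in I]) [set x | W i x = v i]) =
    (\prod_(i <- I) P [set x | W i x = v i])%E.

(* Position of the walk after n steps: p_n = sum_{i<n} e_{W i}, i.e.
   coordinate j counts the steps i < n in direction j. *)
Definition walk_pos (T : Type) (k : nat) (W : nat -> T -> 'I_k) (n : nat) (x : T)
  : 'I_k -> nat :=
  fun j => #|[set i : 'I_n | W (val i) x == j]|.

Definition visible (k : nat) (p : 'I_k -> nat) : bool :=
  (\big[gcdn/0%N]_(j < k) p j) == 1%N.

Definition mean_visible (R : realType) (T : Type) (k : nat)
  (W : nat -> T -> 'I_k) (n : nat) (x : T) : R :=
  (n%:R)^-1 * (\sum_(1 <= i < n.+1) (visible (walk_pos W i x))%:R).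

(* Main.v *)
(** The coordinates of p_i sum to i, so a divisor d of p_i divides i, and for d | i the
    walk is equidistributed among the d^(k-1) compatible residue vectors, up to an error
    K / sqrt L uniform in d and in the position L steps earlier.  This comes from an
    integration by parts: a score supported on the steps of one type has second moment
    proportional to their number, so exchanging one unit step for another changes the
    expectation of a bounded function of the endpoint by O(1 / sqrt L).

    Hence, for lists D_i of O(log i) divisors of i, the sums of [d | p_i] - d^-(k-1) over
    i <= N and d in D_i have second moment O(N^(3/2) log^2 N), and Borel-Cantelli along
    N = m^12 applies.  Taking D_i = {d} (when d | i), the points divisible by d have
    density d^-k almost surely; taking for D_i the prime divisors of i larger than M, the
    points with a common prime factor larger than M have upper density at most 1 / M.
    Sieving by the primes up to M and letting M grow, the Euler product yields 1 / zeta(k). *)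
Require Import Defs.
From HB Require Import structures.
From mathcomp Require Import all_boot all_order all_algebra.
From mathcomp Require Import all_classical all_reals all_analysis.
From mathcomp Require Import ring lra zify.
Set Implicit Arguments. Unset Strict Implicit. Unset Printing Implicit Defensive.
Import Order.TTheory GRing.Theory Num.Theory numFieldNormedType.Exports.
Local Open Scope classical_set_scope.
Local Open Scope ring_scope.

(** * Expectations over finite sequences of independent steps *)

Section PathExpectation.
Context (R : realType) (k : nat) (a : nat -> 'I_k -> R).

(** Expectation over independent steps at times [i], ..., [i + n - 1], step [l] having law [a l]. As
    an iterated finite sum it makes conditioning on the first step a mere computation; the link with
    the measure [P] is made in [prob_path_le]. *)
Fixpoint pathE (i n : nat) (F : seq 'I_k -> R) : R :=
  if n is m.+1 then \sum_j a i j * pathE i.+1 m (fun s => F (j :: s))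
  else F [::].

Lemma eq_pathE i n F G : (forall s, size s = n -> F s = G s) ->
  pathE i n F = pathE i n G.
Proof.
elim: n i F G => [|n IH] i F G FG /=; first exact: FG.
by apply: eq_bigr => j _; congr (_ * _); apply: IH => s sn; apply: FG => /=; rewrite sn.
Qed.

Lemma pathED i n F G : pathE i n (fun s => F s + G s) = pathE i n F + pathE i n G.
Proof.
elim: n i F G => [//|n IH] i F G /=.
by rewrite -big_split; apply: eq_bigr => j _ /=; rewrite IH mulrDr.
Qed.

Lemma pathEZ i n b F : pathE i n (fun s => b * F s) = b * pathE i n F.
Proof.
elim: n i F => [//|n IH] i F /=.
by rewrite big_distrr; apply: eq_bigr => j _ /=; rewrite IH mulrCA.
Qed.

Lemma pathEN i n F : pathE i n (fun s => - F s) = - pathE i n F.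
Proof. by rewrite -mulN1r -pathEZ; apply: eq_pathE => s _; rewrite mulN1r. Qed.

Lemma pathE_sum i n (I : Type) (r : seq I) (F : I -> seq 'I_k -> R) :
  pathE i n (fun s => \sum_(x <- r) F x s) = \sum_(x <- r) pathE i n (F x).
Proof.
elim: r => [|x r IH].
  rewrite big_nil -[RHS](mul0r (pathE i n (fun=> 0))) -pathEZ.
  by apply: eq_pathE => s _; rewrite big_nil mul0r.
by rewrite big_cons -IH -pathED; apply: eq_pathE => s _; rewrite big_cons.
Qed.

Hypothesis a_ge0 : forall i j, 0 <= a i j.
Hypothesis a_sum1 : forall i, \sum_j a i j = 1.

Lemma pathE_cst i n b : pathE i n (fun=> b) = b.
Proof.
elim: n i => [//|n IH] i /=.
by under eq_bigr do rewrite IH; rewrite -big_distrl /= a_sum1 mul1r.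
Qed.

Lemma ler_pathE i n F G : (forall s, size s = n -> F s <= G s) ->
  pathE i n F <= pathE i n G.
Proof.
elim: n i F G => [|n IH] i F G FG /=; first exact: FG.
apply: ler_sum => j _; apply: ler_wpM2l => //.
by apply: IH => s sn; apply: FG => /=; rewrite sn.
Qed.

(** Nonnegativity of the variance: expand the expectation of the squared deviation from the mean
    [m]. *)
Lemma sqr_pathE_le i n F : pathE i n F ^+ 2 <= pathE i n (fun s => F s ^+ 2).
Proof.
set m := pathE i n F.
have : pathE i n (fun=> 0) <= pathE i n (fun s => (F s - m) ^+ 2).
  by apply: ler_pathE => s _; exact: sqr_ge0.
rewrite (@eq_pathE i n (fun s => (F s - m) ^+ 2) (fun s => F s ^+ 2 + ((- 2 * m) * F s + m ^+ 2)));
  last by move=> s _ /=; ring.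
rewrite !pathED pathEZ !pathE_cst -/m; lra.
Qed.

End PathExpectation.

(** * Lattice positions reached by a sequence of steps *)

Section Position.
Context (k : nat).
Implicit Types (v : 'I_k -> nat) (s : seq 'I_k).

Definition step v (j : 'I_k) : 'I_k -> nat := fun l => (v l + (l == j))%N.

Definition endpoint v s : 'I_k -> nat := fun l => (v l + count_mem l s)%N.

Lemma stepC v i j : step (step v i) j = step (step v j) i.
Proof. by apply/funext => l; rewrite /step addnAC. Qed.

Lemma endpoint_nil v : endpoint v [::] = v.
Proof. by apply/funext => l; rewrite /endpoint addn0. Qed.

Lemma endpoint_cons v j s : endpoint v (j :: s) = endpoint (step v j) s.
Proof. by apply/funext => l; rewrite /endpoint /step /= eq_sym addnA. Qed.

Lemma endpoint_step v j s : endpoint (step v j) s = step (endpoint v s) j.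
Proof. by apply/funext => l; rewrite /endpoint /step addnAC. Qed.

Lemma sum_step v j : (\sum_l step v j l = (\sum_l v l).+1)%N.
Proof.
have -> : (\sum_l step v j l = \sum_l v l + \sum_l (l == j))%N by rewrite -big_split.
rewrite -addn1; congr (_ + _)%N.
by rewrite (bigD1 j) //= eqxx big1 // => l /negPf ->.
Qed.

Lemma sum_endpoint v s : (\sum_l endpoint v s l = \sum_l v l + size s)%N.
Proof.
elim: s v => [|j s IH] v; first by rewrite endpoint_nil addn0.
by rewrite endpoint_cons IH sum_step /= addSnnS.
Qed.

End Position.

(** * Smoothness of the endpoint law, by integration by parts *)

Section Smoothing.
Context (R : realType) (k q : nat) (alpha : 'I_q -> 'I_k -> R) (c : nat -> 'I_q).
Hypothesis alpha_gt0 : forall t j, 0 < alpha t j.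
Hypothesis alpha_sum1 : forall t, \sum_j alpha t j = 1.
Let a i := alpha (c i).

Let a_ge0 i j : 0 <= a i j. Proof. exact: ltW (alpha_gt0 _ _). Qed.
Let a_sum1 i : \sum_j a i j = 1. Proof. exact: alpha_sum1. Qed.

Definition endE i n (h : ('I_k -> nat) -> R) v := pathE a i n (fun s => h (endpoint v s)).

Lemma endES i n h v : endE i n.+1 h v = \sum_j a i j * endE i.+1 n h (step v j).
Proof.
apply: eq_bigr => j _; congr (_ * _); apply: eq_pathE => s _.
by rewrite endpoint_cons.
Qed.

Definition typeE t (h : ('I_k -> nat) -> R) v := \sum_j alpha t j * h (step v j).

(** The endpoint ignores the order of steps, so an extra step of type [t] may be taken last or
    first. *)
Lemma endE_typeE i n t h v : endE i n (typeE t h) v = typeE t (endE i n h) v.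
Proof.
rewrite /endE /typeE pathE_sum; apply: eq_bigr => j _.
by rewrite pathEZ; congr (_ * _); apply: eq_pathE => s _; rewrite endpoint_step.
Qed.

Lemma norm_typeE_le t h v : (forall u, `|h u| <= 1) -> `|typeE t h v| <= 1.
Proof.
move=> h1; rewrite -(alpha_sum1 t); apply: le_trans (ler_norm_sum _ _ _) _.
apply: ler_sum => j _; rewrite normrM gtr0_norm //.
by rewrite -[leRHS]mulr1; apply: ler_wpM2l => //; exact: ltW.
Qed.

Context (j1 j2 : 'I_k).
Hypothesis j1j2 : j1 != j2.

(** Logarithmic derivative of the law [alpha t] when mass is moved from direction [j2] to direction
    [j1]. *)
Definition score t j : R := (j == j1)%:R / alpha t j1 - (j == j2)%:R / alpha t j2.

Let expect_score t (f : 'I_k -> R) : \sum_j alpha t j * (score t j * f j) = f j1 - f j2.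
Proof.
rewrite (bigD1 j1) //= (bigD1 j2) 1?eq_sym //= big1 => [|j /andP[/negPf n1 /negPf n2]].
  rewrite /score !eqxx (negPf j1j2) eq_sym (negPf j1j2) mulr1n mulr0n.
  by field; rewrite !gt_eqF.
by rewrite /score n1 n2 !mul0r subrr mul0r mulr0.
Qed.

Let expect_score0 t : \sum_j alpha t j * score t j = 0.
Proof.
rewrite -[RHS](subrr (1 : R)) -(expect_score t (fun=> 1)).
by apply: eq_bigr => j _; rewrite mulr1.
Qed.

Let kappa t := (alpha t j1)^-1 + (alpha t j2)^-1.

Let expect_score2 t : \sum_j alpha t j * score t j ^+ 2 = kappa t.
Proof.
rewrite [LHS](expect_score t (score t)) /score !eqxx (negPf j1j2) eq_sym (negPf j1j2).
rewrite /kappa !mul1r !mul0r; lra.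
Qed.

Fixpoint total_score t i (s : seq 'I_k) : R :=
  if s is j :: s' then (c i == t)%:R * score t j + total_score t i.+1 s' else 0.

Let N t i n : R := \sum_(i <= l < i + n) (c l == t)%:R.

Let NS t i n : N t i n.+1 = (c i == t)%:R + N t i.+1 n.
Proof. by rewrite /N big_ltn ?addnS ?ltnS ?leq_addr // addSn. Qed.

Let N_ge0 t i n : 0 <= N t i n.
Proof. by apply: sumr_ge0 => l _; exact: ler0n. Qed.

Let pathE_total_score t i n : pathE a i n (total_score t i) = 0.
Proof.
elim: n i => [//|n IH] i /=.
under eq_bigr do rewrite pathED IH pathE_cst // addr0 mulrCA.
rewrite -big_distrr /=; have [<-|] := eqVneq; last by rewrite mul0r.
by rewrite expect_score0 mulr0.
Qed.

(** The scores are centred, so the cross terms vanish and the variances add up; [kappa t] is the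
    variance of a single score. *)
Let pathE_total_score2 t i n :
  pathE a i n (fun s => total_score t i s ^+ 2) = N t i n * kappa t.
Proof.
elim: n i => [|n IH] i /=; first by rewrite /N addn0 big_geq // mul0r expr0n.
have E j : pathE a i.+1 n (fun s => total_score t i (j :: s) ^+ 2) =
    (c i == t)%:R * score t j ^+ 2 + N t i.+1 n * kappa t.
  rewrite (@eq_pathE _ _ a _ _ _ (fun s => (c i == t)%:R * score t j ^+ 2 +
    ((2 * ((c i == t)%:R * score t j)) * total_score t i.+1 s +
     total_score t i.+1 s ^+ 2)));
      last by move=> s _ /=; case: (c i == t); rewrite ?mulr1n ?mulr0n; ring.
  by rewrite !pathED pathE_cst // pathEZ pathE_total_score mulr0 add0r IH.
under eq_bigr do rewrite E mulrDr mulrCA.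
rewrite big_split /= -big_distrr -big_distrl /= a_sum1 mul1r NS mulrDl.
congr (_ + _); have [<-|] := eqVneq; last by rewrite !mul0r.
by rewrite expect_score2.
Qed.

(* Integration by parts: summing out a step of type t against its score produces
   the discrete derivative, and the missing step is put back by typeE. *)
Let pathE_score_by_parts t i n h v :
  pathE a i n (fun s => total_score t i s * typeE t h (endpoint v s)) =
  N t i n * (endE i n h (step v j1) - endE i n h (step v j2)).
Proof.
elim: n i v => [|n IH] i v; first by rewrite /N addn0 big_geq //= !mul0r.
rewrite [LHS]/= NS !endES -sumrB.
have E j : pathE a i.+1 n (fun s => total_score t i (j :: s) * typeE t h (endpoint v (j :: s))) =
    (c i == t)%:R * (score t j * endE i.+1 n (typeE t h) (step v j)) +
    N t i.+1 n * (endE i.+1 n h (step (step v j) j1) - endE i.+1 n h (step (step v j) j2)).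
  rewrite -IH /endE mulrA -pathEZ -pathED; apply: eq_pathE => s _ /=.
  by rewrite endpoint_cons; ring.
under eq_bigr do rewrite E mulrDr mulrCA [X in _ + X]mulrCA.
rewrite big_split /= -!big_distrr /= mulrDl; congr (_ + _); last first.
  by congr (_ * _); apply: eq_bigr => j _; rewrite mulrBr !(stepC v j).
have [cit|] := eqVneq; last by rewrite !mul0r.
by rewrite sumrB !mul1r /a cit expect_score !endE_typeE /typeE.
Qed.

(** For each type [t], Cauchy-Schwarz applied to the integration by parts bounds the square of
    [N t i n] times the difference by [N t i n * kappa t]. Cancelling one factor [N t i n] and
    summing over [t] leaves [n] on the left, whatever the frequencies of the types are. *)
Lemma endE_smooth_sqr i n h v : (forall u, `|h u| <= 1) ->
  n%:R * (endE i n h (step v j1) - endE i n h (step v j2)) ^+ 2 <=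
  \sum_t ((alpha t j1)^-1 + (alpha t j2)^-1).
Proof.
move=> h1; set D := _ - _.
have -> : n%:R = \sum_t N t i n :> R.
  rewrite /N exchange_big /= -[in LHS](addKn i n) -[X in X%:R]muln1 -sum_nat_const_nat.
  rewrite natr_sum; apply: eq_bigr => l _.
  by rewrite (bigD1 (c l)) //= eqxx big1 ?addr0 // => t; rewrite eq_sym => /negPf ->.
rewrite big_distrl /=; apply: ler_sum => t _.
have := N_ge0 t i n; rewrite le_eqVlt => /predU1P[<-|N0].
  by rewrite mul0r addr_ge0 // invr_ge0 ltW.
rewrite -(ler_pM2l N0) -pathE_total_score2.
apply: le_trans (_ : pathE a i n (fun s => total_score t i s * typeE t h (endpoint v s)) ^+ 2 <= _).
  by rewrite pathE_score_by_parts -/D mulrA -expr2 exprMn.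
apply: le_trans (sqr_pathE_le _ _ _ _ _) _ => //.
apply: ler_pathE => // s _; rewrite exprMn ler_piMr ?sqr_ge0 //.
by rewrite -real_normK ?num_real // expr_le1 // norm_typeE_le.
Qed.

End Smoothing.

(** * Equidistribution of the endpoint modulo [d] *)

(** A unit shift carries the residues 0, ..., b-1 onto the window 1, ..., b; since b < d, the
    wrap-around to residue 0 happens outside both. *)
Lemma modnS_window b d m : (0 < b < d)%N ->
  (0 < m.+1 %% d <= b)%N = (m %% d < b)%N.
Proof.
move=> /andP[b0 bd]; have d0 : (0 < d)%N by apply: leq_ltn_trans bd.
rewrite -[m.+1]addn1 -modnDml addn1; have := ltn_pmod m d0.
rewrite leq_eqVlt => /predU1P[->|lt_d]; last by rewrite modn_small.
by rewrite modnn /=; apply/esym/negbTE; have := prednK d0; lia.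
Qed.

Section Equidistribution.
Context (R : realType) (k q : nat) (alpha : 'I_q -> 'I_k.+1 -> R) (c : nat -> 'I_q).
Hypothesis alpha_gt0 : forall t j, 0 < alpha t j.
Hypothesis alpha_sum1 : forall t, \sum_j alpha t j = 1.
Context (i n : nat) (delta : R).
Hypothesis smooth : forall h v j1 j2, (forall u, `|h u| <= 1) -> j1 != j2 ->
  `|endE alpha c i n h (step v j1) - endE alpha c i n h (step v j2)| <= delta.
Context (d : nat).
Hypothesis d_gt0 : (0 < d)%N.

(** Coordinates are constrained one after the other. For r at most k the last one stays free: it is
    the reservoir exchanging a unit step with coordinate r, an exchange that [C r] does not see. *)
Let C r (u : 'I_k.+1 -> nat) := [forall j : 'I_k.+1, (j < r)%N ==> (d %| u j)%N].

Let C_step r u (j : 'I_k.+1) : (r <= j)%N -> C r (step u j) = C r u.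
Proof.
move=> rj; apply: eq_forallb => l; case: ltnP => //= lr.
by rewrite /step (_ : l == j = false) ?addn0 //; apply/eqP => lj; move: lr rj; rewrite lj; lia.
Qed.

Let CS r (j : 'I_k.+1) u : j = r :> nat -> C r.+1 u = C r u && (d %| u j)%N.
Proof.
move=> jr; apply/forallP/andP => [H|[/forallP H dj] l].
  split; last by have := H j; rewrite jr ltnSn.
  by apply/forallP => l; apply/implyP => lr; have := H l; rewrite ltnS (ltnW lr).
rewrite ltnS leq_eqVlt; apply/implyP => /predU1P[lr|lr]; last exact: (implyP (H l)).
by rewrite (_ : l = j) //; apply: val_inj; rewrite /= lr jr.
Qed.

Let expect (Q : pred ('I_k.+1 -> nat)) v := endE alpha c i n (fun u => (Q u)%:R) v.

(* Moving one step from the last coordinate to coordinate j rotates the residue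
   of coordinate j; the indicator of a window of residues then compares two classes. *)
Let class_close r (j : 'I_k.+1) v b : j = r :> nat -> (r < k)%N -> (b < d)%N ->
  `|expect (fun u => C r u && (u j %% d == 0)%N) v -
    expect (fun u => C r u && (u j %% d == b)%N) v| <= delta.
Proof.
move=> jr rk bd; have jmax : j != ord_max by apply/eqP => /(congr1 val) /=; lia.
have [->|b0] := posnP b.
  rewrite subrr normr0.
  (* For b = 0 only the nonnegativity of [delta] is at stake, and smoothness of the zero function
     gives it. *)
  apply: le_trans (@smooth (fun=> 0) v j ord_max _ jmax); first exact: normr_ge0.
  by move=> u; rewrite normr0.
pose h u : R := (C r u && (0 < u j %% d <= b)%N)%:R.
have h1 u : `|h u| <= 1 by rewrite /h ger0_norm ?ler0n // lern1 leq_b1.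
apply: le_trans (@smooth h v j ord_max h1 jmax).
rewrite le_eqVlt; apply/orP; left; apply/eqP; congr (`|_|).
rewrite /expect /endE -!pathEN -!pathED; apply: eq_pathE => s _.
rewrite !endpoint_step /h; set u := endpoint v s; rewrite !C_step ?jr //; last by rewrite /= ltnW.
rewrite /step eqxx (negPf jmax) addn0 addn1 modnS_window ?b0 //.
case: (C r u) => //=.
have := ltn_pmod (u j) d_gt0; move: (u j %% d)%N => m md.
have [->|m0] := posnP m; first by rewrite b0 /= [0%N == b]eq_sym (gtn_eqF b0).
by rewrite /= [(m <= b)%N]leq_eqVlt; case: ltngtP => _; rewrite /= ?subrr.
Qed.

Let sum_classes r (j : 'I_k.+1) v :
  \sum_(b < d) expect (fun u => C r u && (u j %% d == b)%N) v = expect (C r) v.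
Proof.
rewrite /expect /endE -pathE_sum; apply: eq_pathE => s _; set u := endpoint v s.
rewrite (bigD1 (Ordinal (ltn_pmod (u j) d_gt0))) //= eqxx andbT big1 ?addr0 // => b nb.
rewrite (_ : _ == _ = false) ?andbF //; apply: contraNF nb => /eqP E.
by apply/eqP/val_inj.
Qed.

(** The event [C r] splits into d residue classes of coordinate r, each within [delta] of the class
    of 0; hence d times the probability of that class is within [d * delta] of the probability of
    [C r]. *)
Let expect_CS r v : (r < k)%N ->
  `|expect (C r.+1) v - expect (C r) v / d%:R| <= delta.
Proof.
move=> rk; have rk1 : (r < k.+1)%N by rewrite ltnW.
pose j := Ordinal rk1.
have E : expect (C r.+1) v = expect (fun u => C r u && (u j %% d == 0)%N) v.
  by apply: eq_pathE => s _; rewrite (CS (j := j)).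
have d0 : 0 < d%:R :> R by rewrite ltr0n.
rewrite -(ler_pM2l d0) -{1}[d%:R]gtr0_norm // -normrM mulrBr.
rewrite [X in _ - X]mulrCA divff ?gt_eqF // mulr1 -(sum_classes r j v) E.
rewrite -[d in d%:R * expect _ _]card_ord mulr_natl -sumr_const -sumrB.
apply: le_trans (ler_norm_sum _ _ _) _.
rewrite -[d in d%:R * delta]card_ord mulr_natl -sumr_const; apply: ler_sum => b _.
exact: (@class_close r).
Qed.

(** Each new coordinate divides the previous error by d, which is at least 1, and adds one
    [delta]. *)
Let expect_C r v : (r <= k)%N ->
  `|expect (C r) v - (d%:R ^+ r)^-1| <= r%:R * delta.
Proof.
elim: r => [|r IH] rk.
  rewrite mul0r expr0 invr1 /expect /endE (@eq_pathE _ _ _ _ _ _ (fun=> 1)).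
    by rewrite pathE_cst // subrr normr0.
  by move=> s _; rewrite (_ : C 0 _) //; apply/forallP => l; rewrite ltn0.
have d1 : 1 <= d%:R :> R by rewrite ler1n.
have d0 : 0 < d%:R :> R by rewrite ltr0n.
have {}IH := IH (ltnW rk).
rewrite -[X in `|X|](subrKA (expect (C r) v / d%:R)).
apply: le_trans (ler_normD _ _) _.
rewrite -natr1 mulrDl mul1r [leLHS]addrC; apply: lerD; last exact: expect_CS.
rewrite exprS invfM mulrC -mulrBr normrM gtr0_norm ?invr_gt0 //.
rewrite -[leRHS]mul1r; apply: ler_pM => //.
by rewrite invf_le1.
Qed.

(** The coordinates sum to [i + n], a multiple of d, so divisibility of the first k forces that of
    the last. This is why the exponent is k although there are k+1 coordinates. *)
Lemma prob_all_dvd v : (\sum_j v j = i)%N -> (d %| i + n)%N ->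
  `|endE alpha c i n (fun u => [forall j, d %| u j]%N%:R) v - (d%:R ^+ k)^-1|
    <= k%:R * delta.
Proof.
move=> vi din; have := @expect_C k v (leqnn k).
rewrite /expect /endE (@eq_pathE _ _ _ _ _ _ (fun s => [forall j, d %| endpoint v s j]%N%:R)) //.
move=> s sn; congr (_%:R); congr nat_of_bool; set u := endpoint v s.
have dsum : (d %| \sum_j u j)%N by rewrite sum_endpoint vi sn.
apply/idP/idP => [Ck|/forallP H]; last by apply/forallP => l; rewrite H implybT.
have H (l : 'I_k.+1) : l != ord_max -> (d %| u l)%N.
  move=> lmax; move/forallP: Ck => /(_ l) /implyP; apply.
  rewrite ltn_neqAle -ltnS ltn_ord andbT.
  by apply: contra lmax => /eqP E; apply/eqP/val_inj.
apply/forallP => l; have [->|/H//] := eqVneq l ord_max.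
rewrite (bigD1 ord_max) //= in dsum; rewrite -(dvdn_addl _ (n := \sum_(j | j != ord_max) u j)) //.
by apply: dvdn_sum => j; exact: H.
Qed.

End Equidistribution.

(** * The smoothing rate, uniform in directions and types *)

Section SmoothingRate.
Context (R : realType) (k q : nat) (alpha : 'I_q -> 'I_k -> R) (c : nat -> 'I_q).
Hypothesis alpha_gt0 : forall t j, 0 < alpha t j.
Hypothesis alpha_sum1 : forall t, \sum_j alpha t j = 1.

(** Summing over all directions dominates the two inverses attached to any pair of distinct
    directions, so one constant serves every pair. *)
Definition smooth_const : R := Num.sqrt (\sum_t \sum_j (alpha t j)^-1).

Lemma endE_smooth i n h v j1 j2 : (0 < n)%N -> (forall u, `|h u| <= 1) -> j1 != j2 ->
  `|endE alpha c i n h (step v j1) - endE alpha c i n h (step v j2)| <=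
  smooth_const / Num.sqrt n%:R.
Proof.
move=> n0 h1 j12; set D := _ - _.
have nR : 0 < n%:R :> R by rewrite ltr0n.
rewrite ler_pdivlMr ?sqrtr_gt0 // -sqrtr_sqr -sqrtrM ?sqr_ge0 // /smooth_const ler_wsqrtr //.
rewrite mulrC; apply: le_trans (endE_smooth_sqr c alpha_gt0 alpha_sum1 j12 i n v h1) _.
apply: ler_sum => t _; rewrite (bigD1 j1) //= lerD2l (bigD1 j2) 1?eq_sym //= lerDl.
by apply: sumr_ge0 => j _; rewrite invr_ge0 ltW.
Qed.

End SmoothingRate.

(** * Second moments of additive functionals of the walk *)

(** With x and y the square roots of n and n+1, the induction step amounts to (y - x)^2 >= 0. *)
Lemma sum_inv_sqrt (R : realType) n :
  \sum_(1 <= l < n.+1) (Num.sqrt l%:R)^-1 <= 2 * Num.sqrt n%:R :> R.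
Proof.
elim: n => [|n IH]; first by rewrite big_geq // sqrtr0 mulr0.
rewrite big_nat_recr //=; apply: le_trans (lerD IH (lexx _)) _.
set x := Num.sqrt n%:R; set y := Num.sqrt n.+1%:R.
have x0 : 0 <= x by exact: sqrtr_ge0.
have y0 : 0 < y by rewrite sqrtr_gt0 ltr0n.
have E : y ^+ 2 = x ^+ 2 + 1 by rewrite !sqr_sqrtr ?ler0n // -natr1.
rewrite -(ler_pM2r y0) mulrDl mulVf ?gt_eqF //.
have : 0 <= (y - x) ^+ 2 by exact: sqr_ge0.
move: E; clearbody x y; nra.
Qed.

Section SecondMoment.
Context (R : realType) (k q : nat) (alpha : 'I_q -> 'I_k -> R) (c : nat -> 'I_q).
Hypothesis alpha_gt0 : forall t j, 0 < alpha t j.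
Hypothesis alpha_sum1 : forall t, \sum_j alpha t j = 1.
Let a i := alpha (c i).
Let a_ge0 i j : 0 <= a i j. Proof. exact: ltW (alpha_gt0 _ _). Qed.
Let a_sum1 i : \sum_j a i j = 1. Proof. exact: alpha_sum1. Qed.

Context (z : nat -> ('I_k -> nat) -> R).

(** The recursion peels off the first step, as [pathE] does; the starting point [v] itself
    contributes nothing. *)
Fixpoint additive_sum i v (s : seq 'I_k) : R :=
  if s is j :: s' then z i.+1 (step v j) + additive_sum i.+1 (step v j) s' else 0.

Lemma additive_sumE i v s :
  additive_sum i v s = \sum_(1 <= l < (size s).+1) z (i + l)%N (endpoint v (take l s)).
Proof.
elim: s i v => [|j s IH] i v /=; first by rewrite big_geq.
rewrite big_ltn // addn1 /= take0 endpoint_cons endpoint_nil IH; congr (_ + _).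
rewrite [RHS]big_add1 /=; apply: eq_bigr => l _.
by rewrite endpoint_cons addSnnS.
Qed.

Lemma pathE_additive_sum i n v : pathE a i n (additive_sum i v) =
  \sum_(1 <= l < n.+1) endE alpha c i l (z (i + l)%N) v.
Proof.
elim: n i v => [|n IH] i v /=; first by rewrite big_geq.
under eq_bigr do rewrite pathED IH pathE_cst // mulrDr big_distrr /=.
rewrite big_split /= exchange_big /= [RHS]big_ltn // addn1; congr (_ + _).
  rewrite endES; apply: eq_bigr => j _.
  by rewrite /endE /= endpoint_nil.
rewrite [RHS]big_add1 /=; apply: eq_bigr => l _.
by rewrite endES addSnnS.
Qed.

Context (B : R) (eta : nat -> R) (N : nat).
Hypothesis eta_ge0 : forall l, 0 <= eta l.
Hypothesis z_bound : forall i u, (0 < i <= N)%N -> `|z i u| <= B.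
Hypothesis z_drift : forall i l v, (\sum_j v j = i)%N -> (0 < l)%N -> (i + l <= N)%N ->
  `|endE alpha c i l (z (i + l)%N) v| <= eta l.

(* Conditioning on the first step: the cross term is the value of z there, at most B,
   times the expectation of the remaining sum, which the drift bounds control. *)
Lemma second_moment i n v : (\sum_j v j = i)%N -> (i + n <= N)%N ->
  pathE a i n (fun s => additive_sum i v s ^+ 2) <=
  n%:R * (B ^+ 2 + 2 * B * \sum_(1 <= l < N.+1) eta l).
Proof.
set S := \sum_(_ <= l < _) _.
elim: n i v => [|n IH] i v vi inN; first by rewrite mul0r /= expr0n.
have B0 : 0 <= B.
  apply: le_trans (@z_bound N v _); rewrite ?normr_ge0 // leqnn andbT.
  by apply: leq_trans inN; rewrite addnS.
have step_le j : pathE a i.+1 n (fun s => additive_sum i v (j :: s) ^+ 2) <=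
    n.+1%:R * (B ^+ 2 + 2 * B * S).
  set x := z i.+1 (step v j).
  have -> : pathE a i.+1 n (fun s => additive_sum i v (j :: s) ^+ 2) =
      x ^+ 2 + 2 * x * pathE a i.+1 n (additive_sum i.+1 (step v j)) +
      pathE a i.+1 n (fun s => additive_sum i.+1 (step v j) s ^+ 2).
    rewrite -pathEZ -[x ^+ 2](pathE_cst a_sum1 i.+1 n) -!pathED.
    by apply: eq_pathE => s _ /=; rewrite -/x; ring.
  have vS : (\sum_j0 step v j j0 = i.+1)%N by rewrite sum_step vi.
  have inS : (i.+1 + n <= N)%N by rewrite addSnnS.
  have := IH _ _ vS inS.
  have xB : `|x| <= B by apply: z_bound; lia.
  have driftS : `|pathE a i.+1 n (additive_sum i.+1 (step v j))| <= S.
    rewrite pathE_additive_sum; apply: le_trans (ler_norm_sum _ _ _) _.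
    have nN : (n.+1 <= N.+1)%N by lia.
    rewrite /S (big_cat_nat _ nN) //=.
    apply: ler_wpDr; first by apply: sumr_ge0.
    by rewrite !big_nat; apply: ler_sum => l /andP[l0 ln]; apply: z_drift => //; lia.
  set E1 := pathE _ _ _ _ in driftS *; set E2 := pathE _ _ _ _.
  have x2 : x ^+ 2 <= B ^+ 2 by rewrite -real_normK ?num_real // lerXn2r ?nnegrE.
  have xE : x * E1 <= B * S.
    by apply: le_trans (ler_norm _) _; rewrite normrM ler_pM.
  rewrite -natr1 mulrDl mul1r => E2_le; nra.
apply: (@le_trans _ _ (\sum_j a i j * (n.+1%:R * (B ^+ 2 + 2 * B * S)))).
  by apply: ler_sum => j _; apply: ler_wpM2l.
by rewrite -big_distrl /= a_sum1 mul1r.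
Qed.

End SecondMoment.

(** * Second moments of sums over divisor lists *)

Section DivisorSums.
Context (R : realType) (k q : nat) (alpha : 'I_q -> 'I_k.+1 -> R) (c : nat -> 'I_q).
Hypothesis alpha_gt0 : forall t j, 0 < alpha t j.
Hypothesis alpha_sum1 : forall t, \sum_j alpha t j = 1.

(** For d dividing i, [d ^- k] is the limiting probability that d divides all k+1 coordinates, so
    each term is nearly centred. *)
Definition divisor_dev (D : nat -> seq nat) i (u : 'I_k.+1 -> nat) : R :=
  \sum_(d <- D i) ([forall j, d %| u j]%N%:R - (d%:R ^+ k)^-1).

Context (D : nat -> seq nat) (B N : nat).
Hypothesis D_dvd : forall i d, d \in D i -> (0 < d)%N && (d %| i)%N.
Hypothesis D_size : forall i, (0 < i <= N)%N -> (size (D i) <= B)%N.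

Let dev_bound i u : (0 < i <= N)%N -> `|divisor_dev D i u| <= B%:R.
Proof.
move=> iN; apply: le_trans (ler_norm_sum _ _ _) _.
apply: (@le_trans _ _ (\sum_(d <- D i) 1)).
  rewrite big_seq [leRHS]big_seq; apply: ler_sum => d /D_dvd /andP[d0 _].
  have : 0 <= (d%:R ^+ k : R)^-1 <= 1.
    rewrite invr_ge0 exprn_ge0 ?ler0n // invf_le1 ?exprn_gt0 ?ltr0n //.
    by rewrite exprn_ege1 // ler1n.
  rewrite ler_norml; case: [forall _, _] => /=; lra.
by rewrite big_const_seq count_predT iter_addr_0 ler_nat D_size.
Qed.

Let dev_drift i l v : (\sum_j v j = i)%N -> (0 < l)%N -> (i + l <= N)%N ->
  `|endE alpha c i l (divisor_dev D (i + l)) v| <=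
  B%:R * (k%:R * (smooth_const alpha / Num.sqrt l%:R)).
Proof.
move=> vi l0 ilN; rewrite /endE /divisor_dev pathE_sum.
apply: le_trans (ler_norm_sum _ _ _) _.
set e := k%:R * _.
have e0 : 0 <= e by rewrite mulr_ge0 // mulr_ge0 ?invr_ge0 ?sqrtr_ge0.
apply: (@le_trans _ _ (\sum_(d <- D (i + l)) e)).
  rewrite big_seq [leRHS]big_seq; apply: ler_sum => d /D_dvd /andP[d0 dil].
  rewrite pathED pathE_cst //.
  apply: prob_all_dvd => //.
  by move=> h w j1 j2; exact: endE_smooth.
rewrite big_const_seq count_predT iter_addr_0 -[e *+ _]mulr_natl ler_wpM2r //.
by rewrite ler_nat D_size //; lia.
Qed.

(** The drift after l steps is of order [1 / sqrt l]. The constant 4 is the factor 2 of the cross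
    term times the factor 2 of [sum_inv_sqrt]. *)
Lemma divisor_dev_second_moment :
  pathE (fun i => alpha (c i)) 0 N
    (fun s => additive_sum (divisor_dev D) 0 (fun=> 0%N) s ^+ 2) <=
  N%:R * B%:R ^+ 2 * (1 + 4 * k%:R * smooth_const alpha * Num.sqrt N%:R).
Proof.
pose eta l : R := B%:R * (k%:R * (smooth_const alpha / Num.sqrt l%:R)).
have K0 : 0 <= smooth_const alpha by exact: sqrtr_ge0.
have eta0 l : 0 <= eta l by rewrite !mulr_ge0 ?invr_ge0 ?sqrtr_ge0.
apply: le_trans (second_moment alpha_gt0 alpha_sum1 eta0 dev_bound dev_drift _ _) _ => //.
  by rewrite big1.
rewrite -[leRHS]mulrA ler_wpM2l // -!big_distrr /=.
have := sum_inv_sqrt R N; set S := \sum_(_ <= l < _) _; set r := Num.sqrt _ => Sr.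
have BK : 0 <= B%:R ^+ 2 * (k%:R * smooth_const alpha) by rewrite !mulr_ge0.
have := ler_wpM2l BK Sr; nra.
Qed.

End DivisorSums.

(** * Tails of the series of inverse powers *)

Lemma inv_exp_le_telescope (R : realType) (s n : nat) : (2 <= s)%N -> (0 < n)%N ->
  (n.+1%:R ^+ s)^-1 <= n%:R^-1 - n.+1%:R^-1 :> R.
Proof.
move=> s2 n0; have nR : 0 < n%:R :> R by rewrite ltr0n.
have n1R : 0 < n.+1%:R :> R by rewrite ltr0n.
have -> : n%:R^-1 - n.+1%:R^-1 = (n%:R * n.+1%:R)^-1 :> R.
  by rewrite -natr1; field; rewrite natr1 !gt_eqF.
rewrite lef_pV2 ?posrE ?mulr_gt0 ?exprn_gt0 //.
apply: (@le_trans _ _ (n.+1%:R ^+ 2)); last by rewrite ler_eXn2l // ltr1n.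
by rewrite expr2 ler_pM2r // ler_nat.
Qed.

Lemma sum_inv_exp_tail (R : realType) (s M N : nat) : (2 <= s)%N -> (0 < M)%N ->
  \sum_(M.+1 <= n < N.+1) (n%:R ^+ s)^-1 <= M%:R^-1 :> R.
Proof.
move=> s2 M0.
have [NM|/ltnW MN] := leqP N M; first by rewrite big_geq // invr_ge0 ler0n.
rewrite big_add1 /=; apply: (@le_trans _ _ (M%:R^-1 - N%:R^-1)).
  rewrite -(opprB (N%:R^-1)) -(telescope_sumr (fun n => n%:R^-1)) // -sumrN.
  rewrite !big_nat; apply: ler_sum => n /andP[Mn _]; rewrite opprB.
  by apply: inv_exp_le_telescope => //; exact: leq_trans Mn.
by rewrite gerBl invr_ge0 ler0n.
Qed.

(** * Probabilities of path events bounded by path expectations *)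

Lemma measure_bigsetU_le d (T : measurableType d) (R : realType)
    (mu : {measure set T -> \bar R}) (I : Type) (r : seq I) (F : I -> set T) :
  (forall i, measurable (F i)) ->
  (mu (\big[setU/set0]_(i <- r) F i) <= \sum_(i <- r) mu (F i))%E.
Proof.
move=> mF; elim: r => [|i r IH]; first by rewrite !big_nil measure0.
rewrite !big_cons; apply: le_trans (measureU2 _ _ _) _ => //.
  by apply: bigsetU_measurable.
by rewrite leeD2l.
Qed.

Section PathLaw.
Context (R : realType) (k : nat) (a : nat -> 'I_k.+1 -> R).
Context (d : measure_display) (T : measurableType d) (P : probability T R).
Context (W : nat -> T -> 'I_k.+1).
Hypothesis Wmeas : forall i j, measurable [set x | W i x = j].
Hypothesis Wlaw : forall i j, P [set x | W i x = j] = (a i j)%:E.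
Hypothesis Wind : mutually_independent_discrete P W.

Let path n x := mkseq (fun i => W i x) n.

Let prefixE s : [set x | path (size s) x = s] =
  \bigcap_(i in [set i | i \in iota 0 (size s)]) [set x | W i x = nth ord0 s i].
Proof.
apply/seteqP; split => x /=.
  by move=> E i; rewrite /= mem_iota /= add0n => ilt; rewrite -[in RHS]E nth_mkseq.
move=> H; apply: (@eq_from_nth _ ord0) => [|i]; rewrite size_mkseq // => ilt.
by rewrite nth_mkseq //; apply: H; rewrite /= mem_iota.
Qed.

Let prob_prefix s : P [set x | path (size s) x = s] =
  (\prod_(i < size s) a i (nth ord0 s i))%:E.
Proof.
rewrite prefixE Wind ?iota_uniq //.
under eq_bigr do rewrite Wlaw.
by rewrite prodEFin -(big_mkord xpredT (fun i => a i (nth ord0 s i))) /index_iota subn0.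
Qed.

Let measurable_prefix s : measurable [set x | path (size s) x = s].
Proof. by rewrite prefixE; apply: fin_bigcap_measurable => //; exact: finite_seq. Qed.

(** Induction on the number of steps still to come: the event is split according to the next step
    and bounded by subadditivity. Once the whole path is prescribed, independence gives its
    probability as a product. *)
Let prob_path_extend (Q : pred (seq 'I_k.+1)) n s :
  let E := [set x | path (size s) x = s] `&` [set x | Q (path (size s + n) x)] in
  measurable E /\ (P E <=
    (\prod_(i < size s) a i (nth ord0 s i) *
      pathE a (size s) n (fun r => (Q (s ++ r))%:R))%:E)%E.
Proof.
elim: n s => [|n IH] s /=.
  rewrite addn0 cats0; have [Qs|nQs] := boolP (Q s).
    rewrite mulr1 -prob_prefix (_ : _ `&` _ = [set x | path (size s) x = s]) //.
    by apply/seteqP; split => x /= [] // E; rewrite E.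
  rewrite mulr0 (_ : _ `&` _ = set0) ?measure0 //.
  by apply/seteqP; split => x //= [E]; rewrite E (negPf nQs).
pose F j := [set x | path (size (rcons s j)) x = rcons s j] `&`
            [set x | Q (path (size (rcons s j) + n) x)].
have -> : [set x | path (size s) x = s] `&` [set x | Q (path (size s + n.+1) x)] =
    \big[setU/set0]_(j <- enum 'I_k.+1) F j.
  rewrite -bigcup_seq; apply/seteqP; split => x /=.
    move=> [E Qx]; exists (W (size s) x); first by rewrite /= mem_enum.
    rewrite /F /= size_rcons addSnnS; split => //.
    by rewrite /path mkseqS; congr rcons.
  move=> [j _ []] /=; rewrite size_rcons addSnnS /path mkseqS => /rcons_inj[E _] Qx.
  by split.
split; first by apply: bigsetU_measurable => j _; have [] := IH (rcons s j).
apply: le_trans (@measure_bigsetU_le _ _ _ P _ (enum 'I_k.+1) F _) _.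
  by move=> j; have [] := IH (rcons s j).
rewrite big_distrr /= -sumEFin big_enum; apply: lee_sum => j _.
apply: le_trans (IH (rcons s j)).2 _; rewrite lee_fin size_rcons big_ord_recr /=.
rewrite nth_rcons ltnn eqxx -mulrA (eq_bigr (fun i : 'I__ => a i (nth ord0 s i))).
  by rewrite (@eq_pathE _ _ _ _ _ _ (fun r => (Q (s ++ j :: r))%:R)) // => r _; rewrite cat_rcons.
by move=> i _; rewrite nth_rcons ltn_ord.
Qed.

Lemma prob_path_le (Q : pred (seq 'I_k.+1)) n :
  measurable [set x | Q (mkseq (fun i => W i x) n)] /\
  (P [set x | Q (mkseq (fun i => W i x) n)] <= (pathE a 0 n (fun s => (Q s)%:R))%:E)%E.
Proof.
have := prob_path_extend Q n [::].
rewrite /= big_ord0 mul1r add0n (_ : _ `&` _ = [set x | Q (path n x)]) //.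
by apply/seteqP; split => x //= [].
Qed.

End PathLaw.

(** * Almost sure bounds for divisor sums along twelfth powers *)

Definition walk_gcd (T : Type) (k : nat) (W : nat -> T -> 'I_k) (i : nat) (x : T) : nat :=
  \big[gcdn/0%N]_(j < k) walk_pos W i x j.

Lemma endpoint_walk_pos (T : Type) (k : nat) (W : nat -> T -> 'I_k) n x :
  endpoint (fun=> 0%N) (mkseq (fun i => W i x) n) = walk_pos W n x.
Proof.
apply/funext => j; rewrite /endpoint add0n /walk_pos -sum1_card -sum1_count big_map.
rewrite (_ : iota 0 n = index_iota 0 n) /index_iota ?subn0 // -[n in iota 0 n]subn0.
rewrite -/(index_iota 0 n) big_mkord; apply: eq_bigl => i.
by rewrite unfold_in /in_set /mkset asboolb.
Qed.

(* Along N = m^12 the second moment of the divisor sum is O(m^20), because at most 12 m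
   divisors occur at each time; so Chebyshev at level m^11 gives probabilities O(m^-2). *)
Section BorelCantelli.
Context (R : realType) (k q : nat) (alpha : 'I_q -> 'I_k.+1 -> R) (c : nat -> 'I_q).
Hypothesis alpha_gt0 : forall t j, 0 < alpha t j.
Hypothesis alpha_sum1 : forall t, \sum_j alpha t j = 1.
Context (d : measure_display) (T : measurableType d) (P : probability T R).
Context (W : nat -> T -> 'I_k.+1).
Hypothesis Wmeas : forall i j, measurable [set x | W i x = j].
Hypothesis Wlaw : forall i j, P [set x | W i x = j] = (alpha (c i) j)%:E.
Hypothesis Wind : mutually_independent_discrete P W.
Context (D : nat -> seq nat).
Hypothesis D_dvd : forall i e, e \in D i -> (0 < e)%N && (e %| i)%N.
Hypothesis D_size : forall i, (0 < i)%N -> (2 ^ size (D i) <= 2 * i)%N.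

Let F := additive_sum (divisor_dev R (k := k) D) 0 (fun=> 0%N).
Let bad m := [set x | m%:R ^+ 11 < `|F (mkseq (fun i => W i x) (m ^ 12))|].

Let FE n x : F (mkseq (fun i => W i x) n) =
  \sum_(1 <= i < n.+1) \sum_(e <- D i) ((e %| walk_gcd W i x)%N%:R - (e%:R ^+ k)^-1).
Proof.
rewrite /F additive_sumE size_mkseq !big_nat; apply: eq_bigr => i /andP[_ ilt].
rewrite add0n /divisor_dev; apply: eq_bigr => e _; congr (_%:R - _); congr nat_of_bool.
rewrite -map_take take_iota (minn_idPl _) // -/(mkseq _ _) endpoint_walk_pos.
by apply/forallP/dvdn_biggcdP => H j //; exact: H.
Qed.

Let second_moment_pow m : (0 < m)%N ->
  pathE (fun i => alpha (c i)) 0 (m ^ 12) (fun s => F s ^+ 2) <=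
  144 * (1 + 4 * k%:R * smooth_const alpha) * m%:R ^+ 20.
Proof.
move=> m0; have mR : 1 <= m%:R :> R by rewrite ler1n.
have K0 : 0 <= smooth_const alpha by exact: sqrtr_ge0.
(* Since m < 2^m, [2 ^ size (D i) <= 2 * m ^ 12 < 2 ^ (12 * m + 1)]; the square of 12 is the
   constant 144. *)
have sz i : (0 < i <= m ^ 12)%N -> (size (D i) <= 12 * m)%N.
  move=> /andP[i0 im]; rewrite -ltnS -(ltn_exp2l _ _ (isT : 1 < 2)%N).
  apply: leq_ltn_trans (D_size i0) _; rewrite expnS ltn_mul2l /=.
  apply: leq_ltn_trans im _; rewrite mulnC expnM.
  by rewrite ltn_exp2r // ltn_expl.
apply: le_trans (divisor_dev_second_moment c alpha_gt0 alpha_sum1 D_dvd sz) _.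
have -> : Num.sqrt (m ^ 12)%:R = m%:R ^+ 6 :> R.
  by rewrite natrX (exprM _ 6 2) sqrtr_sqr ger0_norm // exprn_ge0.
rewrite natrX natrM.
have m6 : 1 <= m%:R ^+ 6 :> R by exact: exprn_ege1.
have -> : (m%:R : R) ^+ 20 = m%:R ^+ 12 * m%:R ^+ 2 * m%:R ^+ 6 by rewrite -!exprD.
have KK : 0 <= 4 * k%:R * smooth_const alpha by rewrite !mulr_ge0.
have M0 : 0 <= (m%:R : R) ^+ 12 * m%:R ^+ 2 by rewrite mulr_ge0 // exprn_ge0.
have := ler_wpM2l M0 m6; rewrite exprMn; nra.
Qed.

Let bad_prob m : measurable (bad m) /\
  (P (bad m) <= (144 * (1 + 4 * k%:R * smooth_const alpha) * (m%:R ^+ 2)^-1)%:E)%E.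
Proof.
pose Q s := m%:R ^+ 11 < `|F s|.
have [mQ PQ] := prob_path_le Wmeas Wlaw Wind Q (m ^ 12).
split=> //; apply: le_trans PQ _; rewrite lee_fin.
have [m0|m0] := posnP m.
  (* At m = 0 the path is empty and its sum is 0, so the event is void; the bound is 0 too, as the
     inverse of 0 is 0. *)
  by rewrite /Q m0 exp0n //= !expr0n /= normr0 ltxx invr0 mulr0.
have mR : 0 < m%:R :> R by rewrite ltr0n.
have m22 : 0 < (m%:R : R) ^+ 22 by exact: exprn_gt0.
(* Chebyshev's inequality, multiplied through by the squared threshold [m ^ 22]. *)
rewrite -(ler_pM2l m22) -pathEZ.
apply: (@le_trans _ _ (pathE (fun i => alpha (c i)) 0 (m ^ 12) (fun s => F s ^+ 2))).
  apply: ler_pathE => [i j|s _]; first exact/ltW.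
  rewrite /Q; case: ltP => [lt|_]; last by rewrite mulr0 sqr_ge0.
  rewrite mulr1 (exprM _ 11 2) -[leRHS]real_normK ?num_real //.
  by apply: lerXn2r; rewrite ?nnegrE ?exprn_ge0 // ltW.
apply: le_trans (second_moment_pow m0) _; rewrite le_eqVlt; apply/orP; left; apply/eqP.
by field; rewrite gt_eqF.
Qed.

Lemma ae_divisor_sum_small : {ae P, forall x, \forall m \near \oo,
  `|\sum_(1 <= i < (m ^ 12).+1)
      \sum_(e <- D i) ((e %| walk_gcd W i x)%N%:R - (e%:R ^+ k)^-1)| <= m%:R ^+ 11 :> R}.
Proof.
have K0 : 0 <= smooth_const alpha by exact: sqrtr_ge0.
set C := 144 * (1 + 4 * k%:R * smooth_const alpha) : R.
have C0 : 0 <= C by rewrite mulr_ge0 // addr_ge0 // !mulr_ge0.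
have sumP : (\sum_(n <oo) P (bad n) < +oo)%E.
  apply: (@le_lt_trans _ _ (C * 2)%:E); last exact: ltry.
  apply: lime_le; first by apply: is_cvg_nneseries => n _ _; exact: measure_ge0.
  apply: nearW => n; apply: (@le_trans _ _ (\sum_(0 <= i < n) (C * (i%:R ^+ 2)^-1)%:E)%E).
    by apply: lee_sum => i _; have [] := bad_prob i.
  rewrite sumEFin lee_fin -big_distrr ler_wpM2l //=.
  (* Two further terms make it possible to split off the indices 0 and 1 for every n; they
     contribute 0 and 1, and the tail at most 1. *)
  apply: (@le_trans _ _ (\sum_(0 <= i < n.+2) (i%:R ^+ 2)^-1)).
    have nn : (n <= n.+2)%N by lia.
    by rewrite [leRHS](big_cat_nat _ nn) //= lerDl sumr_ge0 // => i _; rewrite invr_ge0 exprn_ge0.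
  rewrite big_ltn // expr0n invr0 add0r big_ltn // expr1n invr1.
  have := @sum_inv_exp_tail R 2 1 n.+1 isT isT; rewrite invr1; lra.
exists (lim_sup_set bad); split.
- apply: bigcap_measurableType => n _; apply: bigcup_measurable => j _.
  by have [] := bad_prob j.
- by apply: lim_sup_set_cvg0 sumP => n; have [] := bad_prob n.
move=> x /= nx n _; apply: contrapT => good; apply: nx.
exists n => // m /= nm; rewrite -FE leNgt; apply/negP => bm.
by apply: good; exists m.
Qed.

End BorelCantelli.

(** * The sieved zeta series and the Euler product *)

Lemma sum_multiples (R : realType) (F : nat -> R) p N : (0 < p)%N ->
  \sum_(1 <= n < N.+1) (p %| n)%N%:R * F n = \sum_(1 <= m < (N %/ p).+1) F (p * m)%N.
Proof.
move=> p0; elim: N => [|N IH]; first by rewrite div0n !big_geq.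
rewrite big_nat_recr //= IH divnS //; have [pN|] := boolP (p %| N.+1)%N; last first.
  by rewrite mul0r addr0 add0n.
rewrite add1n [RHS]big_nat_recr //= mul1r; congr (_ + F _).
by rewrite mulnC -[(_ %/ p).+1]add1n -(_ : N.+1 %/ p = 1 + N %/ p)%N ?divnK // divnS // pN.
Qed.

Section EulerProduct.
Context (R : realType) (s : nat).
Hypothesis s2 : (2 <= s)%N.

Definition euler_prod (S : seq nat) : R := \prod_(p <- S) (1 - (p%:R ^+ s)^-1).

Definition free_of (S : seq nat) (n : nat) : bool := all (fun p => ~~ (p %| n)%N) S.

Let sieved S N : R := \sum_(1 <= n < N.+1) (free_of S n)%:R * (n%:R ^+ s)^-1.

Let sieved_nil_cvg : sieved [::] N @[N --> \oo] --> zeta R s.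
Proof.
have E : (fun N => sieved [::] N) = series (fun m : nat => ((m.+1)%:R ^+ s)^-1).
  apply/funext => N; rewrite /sieved /series /= big_add1 /=.
  by apply: eq_bigr => m _; rewrite mul1r.
rewrite E; apply: nondecreasing_is_cvgn.
  apply/nondecreasing_seqP => n; rewrite /series /= big_nat_recr //= lerDl.
  by rewrite invr_ge0 exprn_ge0.
(* The first term is 1 and the others sum to at most 1. *)
exists 2 => _ [N _ <-]; rewrite -E /sieved.
have [->|N0] := posnP N; first by rewrite big_geq.
rewrite big_ltn // /= mul1r expr1n invr1.
under eq_bigr do rewrite mul1r.
have := @sum_inv_exp_tail R s 1 N s2 isT; rewrite invr1; lra.
Qed.

Lemma free_of_mul p S m : prime p -> all prime S -> p \notin S ->
  free_of S (p * m) = free_of S m.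
Proof.
move=> pp /allP prS pS; apply: eq_in_all => r rS; have pr := prS r rS.
rewrite Euclid_dvdM // dvdn_prime2 //; case: eqP => //= rp.
by rewrite -rp rS in pS.
Qed.

(** The terms removed are those with n = p m; as p is a prime outside [S], n is free of [S] exactly
    when m is, and the factor [p ^- s] comes out. *)
Let sieved_cons p S N : prime p -> all prime S -> p \notin S ->
  sieved (p :: S) N = sieved S N - (p%:R ^+ s)^-1 * sieved S (N %/ p).
Proof.
move=> pp prS pS; rewrite /sieved big_distrr /=.
have -> : \sum_(1 <= i < (N %/ p).+1) (p%:R ^+ s)^-1 * ((free_of S i)%:R * (i%:R ^+ s)^-1)
   = \sum_(1 <= n < N.+1) (p %| n)%N%:R * ((free_of S n)%:R * (n%:R ^+ s)^-1) :> R.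
  rewrite sum_multiples ?prime_gt0 //; apply: eq_bigr => m _.
  by rewrite free_of_mul // natrM exprMn invfM mulrCA.
rewrite -sumrB; apply: eq_bigr => n _.
by case: (p %| n)%N => /=; rewrite ?mul0r ?mul1r ?subrr ?subr0.
Qed.

Let cvg_divn p : (0 < p)%N -> (N %/ p)%N @[N --> \oo] --> \oo.
Proof.
move=> p0; apply/cvgnyPge => A; exists (A * p)%N => // N /= AN.
by rewrite leq_divRL.
Qed.

Let sieved_cvg S : uniq S -> all prime S ->
  sieved S N @[N --> \oo] --> zeta R s * euler_prod S.
Proof.
elim: S => [|p S IH] /=; first by rewrite /euler_prod big_nil mulr1.
move=> /andP[pS uS] /andP[pp prS]; rewrite /euler_prod big_cons mulrCA mulrBl mul1r.
have {}IH := IH uS prS.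
under eq_fun do rewrite sieved_cons //.
apply: cvgB => //; apply: cvgMr.
exact: (cvg_comp _ _ (cvg_divn (prime_gt0 pp)) IH).
Qed.

Definition primes_upto M := [seq p <- iota 0 M.+1 | prime p].

Lemma uniq_primes_upto M : uniq (primes_upto M).
Proof. by rewrite filter_uniq // iota_uniq. Qed.

Lemma all_prime_primes_upto M : all prime (primes_upto M).
Proof. exact: filter_all. Qed.

Lemma free_of_primes_upto1 M : free_of (primes_upto M) 1.
Proof.
by apply/allP => p; rewrite mem_filter dvdn1 => /andP[pp _]; apply: contraTneq pp => ->.
Qed.

Let sieved_ge1 M N : (0 < N)%N -> 1 <= sieved (primes_upto M) N.
Proof.
move=> N0; rewrite /sieved big_ltn // free_of_primes_upto1.
by rewrite mul1r expr1n invr1 lerDl sumr_ge0.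
Qed.

(** An integer between 2 and M has a prime factor at most M, so only 1 and integers beyond M survive
    the sieve. *)
Let sieved_le M N : (0 < M)%N -> (M <= N)%N -> sieved (primes_upto M) N <= 1 + M%:R^-1.
Proof.
move=> M0 MN; rewrite /sieved; have MN1 : (M.+1 <= N.+1)%N by [].
rewrite (big_cat_nat _ MN1) //=; apply: lerD; last first.
  apply: le_trans (sum_inv_exp_tail R N s2 M0); apply: ler_sum => n _.
  by rewrite ler_piMl ?invr_ge0 ?exprn_ge0 // lern1 leq_b1.
rewrite big_ltn // big_nat big1 ?addr0.
  by rewrite expr1n invr1 mulr1 lern1 leq_b1.
move=> n /andP[n2 nM]; rewrite (_ : free_of _ n = false) ?mul0r //.
apply/negbTE; rewrite -has_predC; apply/hasP; exists (pdiv n).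
  rewrite mem_filter pdiv_prime // mem_iota /= add0n.
  by apply: leq_ltn_trans nM; exact: pdiv_leq (ltnW n2).
by rewrite /= negbK pdiv_dvd.
Qed.

Lemma zeta_ge1 : 1 <= zeta R s.
Proof.
(* [primes_upto 0] is empty, so nothing is sieved out and the limit is the zeta value itself. *)
have := sieved_cvg (uniq_primes_upto 0) (all_prime_primes_upto 0).
rewrite /euler_prod big_nil mulr1 => /cvg_lim <- //.
apply: limr_ge; first by apply/cvg_ex; exists (zeta R s); exact: sieved_nil_cvg.
by exists 1%N => // N /= N0; exact: (sieved_ge1 0).
Qed.

(** Zeta times the finite product lies between 1 and 1 + 1/M; dividing by zeta, which is at least 1,
    only shrinks the gap. *)
Lemma euler_prod_close M : (0 < M)%N ->
  `|euler_prod (primes_upto M) - (zeta R s)^-1| <= M%:R^-1.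
Proof.
move=> M0; have lim := sieved_cvg (uniq_primes_upto M) (all_prime_primes_upto M).
have clim : cvgn (sieved (primes_upto M)) by apply/cvg_ex; eexists; exact: lim.
have z1 := zeta_ge1; have z0 : 0 < zeta R s by lra.
have lo : 1 <= zeta R s * euler_prod (primes_upto M).
  move: (lim) => /cvg_lim <- //; apply: limr_ge => //.
  by exists 1%N => // N /= N0; exact: sieved_ge1.
have hi : zeta R s * euler_prod (primes_upto M) <= 1 + M%:R^-1.
  move: (lim) => /cvg_lim <- //; apply: limr_le => //.
  by exists M => // N /= MN; exact: sieved_le.
rewrite -(ler_pM2l z0) -{1}(gtr0_norm z0) -normrM mulrBr divff ?gt_eqF //.
have MI : 0 <= M%:R^-1 :> R by rewrite invr_ge0.
rewrite ger0_norm ?subr_ge0 //; nra.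
Qed.

End EulerProduct.

(** * Densities along a subsequence of times, and the sieve for gcd 1 *)

Section Density.
Context (R : realType).

Definition average (F : nat -> R) (N : nat) : R := N%:R^-1 * \sum_(1 <= i < N.+1) F i.

Lemma averageD F G N : average (fun i => F i + G i) N = average F N + average G N.
Proof. by rewrite /average big_split mulrDr. Qed.

Lemma averageB F G N : average (fun i => F i - G i) N = average F N - average G N.
Proof. by rewrite /average sumrB mulrBr. Qed.

Lemma eq_average F G N : (forall i, (0 < i)%N -> F i = G i) -> average F N = average G N.
Proof.
move=> FG; rewrite /average !big_nat; congr (_ * _).
by apply: eq_bigr => i /andP[i0 _]; exact: FG.
Qed.

Lemma ler_average F G N : (forall i, (0 < i)%N -> F i <= G i) -> average F N <= average G N.
Proof.
move=> FG; rewrite /average !big_nat ler_wpM2l ?invr_ge0 //.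
by apply: ler_sum => i /andP[i0 _]; exact: FG.
Qed.

Context (s : nat) (g : nat -> nat) (N : nat -> nat).
Hypothesis s2 : (2 <= s)%N.
Hypothesis g_dvd : forall i, (g i %| i)%N.
Hypothesis density_dvd : forall d, (0 < d)%N ->
  average (fun i => (d %| g i)%N%:R) (N m) @[m --> \oo] --> ((d%:R ^+ s)^-1 : R).

(** Sieving by one more prime p subtracts the density for [p * d] from that for [d], which produces
    the factor [1 - p ^- s]. The parameter [d] is there for this induction. *)
Lemma density_free S d : (0 < d)%N -> uniq S -> all prime S -> free_of S d ->
  average (fun i => ((d %| g i)%N && free_of S (g i))%:R) (N m) @[m --> \oo] -->
  ((d%:R ^+ s)^-1 * euler_prod R s S : R).
Proof.
elim: S d => [|p S IH] d d0.
  move=> _ _ _; rewrite /euler_prod big_nil mulr1.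
  by under eq_fun do under eq_average do rewrite andbT; exact: density_dvd.
move=> /= /andP[pS uS] /andP[pp prS] /andP[pd Sd].
have pd0 : (0 < p * d)%N by rewrite muln_gt0 prime_gt0.
have pSd : free_of S (p * d) by rewrite free_of_mul.
rewrite /euler_prod big_cons mulrA mulrBr mulr1 -invfM -exprMn [d%:R * _]mulrC -natrM mulrBl.
rewrite (_ : (fun m => _) = (fun m =>
  average (fun i => ((d %| g i)%N && free_of S (g i))%:R) (N m) -
  average (fun i => ((p * d %| g i)%N && free_of S (g i))%:R) (N m))).
  by apply: cvgB; exact: IH.
apply/funext => m; rewrite -averageB; apply: eq_average => i _.
rewrite Gauss_dvd ?prime_coprime //= -/(free_of S (g i)).
by case: (p %| g i)%N; case: (d %| g i)%N; case: (free_of _ _); rewrite /= ?subrr ?subr0.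
Qed.

(** Taken among the prime divisors of the time i, the list does not depend on the random position;
    as [g i] divides i, it misses no prime factor of [g i] above M. *)
Definition large_primes M i := [seq p <- primes i | (M < p)%N].

Hypothesis large_primes_rare : forall M e, (0 < M)%N -> 0 < e ->
  \forall m \near \oo,
    average (fun i => \sum_(p <- large_primes M i) (p %| g i)%N%:R) (N m) <= M%:R^-1 + e.

Lemma density_coprime :
  average (fun i => (g i == 1)%N%:R) (N m) @[m --> \oo] --> (zeta R s)^-1.
Proof.
apply/cvgrPdist_le => e e0.
(* The error splits into four quarters of e: the sieved density, the truncated Euler product, and
   both terms [M^-1] and [e / 4] of the large-prime bound. *)
pose M := (Num.truncn (4 / e)).+1.
have M0 : (0 < M)%N by [].
have Me : M%:R^-1 <= e / 4 :> R.
  rewrite -[e / 4]invrK invf_div lef_pV2 ?posrE ?divr_gt0 ?ltr0n //.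
  by apply: ltW; exact: truncnS_gt.
have e4 : 0 < e / 4 by rewrite divr_gt0.
have EM := @density_free (primes_upto M) 1 isT (uniq_primes_upto M) (all_prime_primes_upto M).
have f1 := free_of_primes_upto1 M.
have {EM} /cvgrPdist_le /(_ _ e4) EM := EM f1.
have TM := large_primes_rare M0 e4.
have zM := euler_prod_close R s2 M0.
near=> m.
have : `|(1%:R ^+ s)^-1 * euler_prod R s (primes_upto M) -
    average (fun i => ((1 %| g i)%N && free_of (primes_upto M) (g i))%:R) (N m)| <= e / 4.
  by near: m.
rewrite expr1n invr1 mul1r (@eq_average _ (fun i => (free_of (primes_upto M) (g i))%:R));
  last by move=> i _; rewrite dvd1n.
have T4 : average (fun i => \sum_(p <- large_primes M i) (p %| g i)%N%:R) (N m)
    <= M%:R^-1 + e / 4 by near: m.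
have X_le : average (fun i => (g i == 1)%N%:R) (N m) <=
    average (fun i => (free_of (primes_upto M) (g i))%:R) (N m).
  apply: ler_average => i _; rewrite ler_nat.
  by case: eqVneq => // ->; rewrite f1.
have X_ge : average (fun i => (free_of (primes_upto M) (g i))%:R) (N m) <=
    average (fun i => (g i == 1)%N%:R) (N m) +
    average (fun i => \sum_(p <- large_primes M i) (p %| g i)%N%:R) (N m).
  rewrite -averageD; apply: ler_average => i i0.
  have sum_ge0 r : 0 <= \sum_(p <- r) (p %| g i)%N%:R :> R by exact: sumr_ge0.
  have [g1|g1] := eqVneq (g i) 1%N; first by rewrite g1 f1 lerDl -g1.
  rewrite add0r; have [fg|] := boolP (free_of _ _); last by rewrite sum_ge0.
  have gi0 : (0 < g i)%N by apply: dvdn_gt0 (g_dvd i).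
  have g2 : (1 < g i)%N by rewrite ltn_neqAle eq_sym g1.
  (* A value [g i] other than 1 that survives the sieve has its least prime factor above M, so the
     large-prime sum is at least 1. *)
  have pg : pdiv (g i) \in large_primes M i.
    rewrite mem_filter mem_primes pdiv_prime // i0 (dvdn_trans (pdiv_dvd _) (g_dvd i)) /= andbT.
    rewrite ltnNge; apply/negP => pM; move/allP: fg => /(_ (pdiv (g i))).
    by rewrite mem_filter pdiv_prime // mem_iota /= add0n ltnS pM pdiv_dvd => /(_ isT).
  by rewrite (big_rem _ pg) /= pdiv_dvd lerDl.
move: zM; rewrite !ler_norml; lra.
Unshelve. all: by end_near.
Qed.

End Density.

(** * Counting prime divisors, and densities along twelfth powers *)

Lemma prodn_ge_pow2 (r : seq nat) (F : nat -> nat) :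
  (forall p, p \in r -> 2 <= F p)%N -> (2 ^ size r <= \prod_(p <- r) F p)%N.
Proof.
elim: r => [|p r IH] H; first by rewrite big_nil.
rewrite big_cons expnS leq_mul ?H ?mem_head //.
by apply: IH => p' p'r; rewrite H // in_cons p'r orbT.
Qed.

Lemma size_primes_le i : (0 < i)%N -> (2 ^ size (primes i) <= i)%N.
Proof.
move=> i0; rewrite [leqRHS]prod_prime_decomp // prime_decompE big_map /=.
apply: prodn_ge_pow2 => p; rewrite mem_primes => /and3P[pp _ pi].
have lp : (0 < logn p i)%N by rewrite logn_gt0 mem_primes pp i0 pi.
apply: leq_trans (prime_gt1 pp) _; rewrite /= /pfactor -{1}[p]expn1.
exact: leq_pexp2l (prime_gt0 pp) lp.
Qed.

Lemma natr_exp12_gt0 (R : realType) m : (0 < m)%N -> 0 < (m ^ 12)%:R :> R.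
Proof. by move=> m0; rewrite ltr0n expn_gt0 m0. Qed.

Section DivisorSumAverages.
Context (R : realType) (k : nat) (g : nat -> nat).
Hypothesis k0 : (0 < k)%N.
Hypothesis g_dvd : forall i, (g i %| i)%N.

Let small (D : nat -> seq nat) := \forall m \near \oo,
  `|\sum_(1 <= i < (m ^ 12).+1)
      \sum_(e <- D i) ((e %| g i)%N%:R - (e%:R ^+ k)^-1)| <= m%:R ^+ 11 :> R.

Let small_average (S : R) m : (0 < m)%N -> `|S| <= m%:R ^+ 11 ->
  `|(m ^ 12)%:R^-1 * S| <= m%:R^-1.
Proof.
move=> m0 Sm; have mR : 0 < m%:R :> R by rewrite ltr0n.
have m12 := natr_exp12_gt0 R m0.
rewrite normrM gtr0_norm ?invr_gt0 // ler_pdivrMl // natrX exprSr -mulrA divff ?gt_eqF //.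
by rewrite mulr1.
Qed.

Let near_inv (e b : R) : 0 < e -> 0 < b -> \forall m \near \oo, b / m%:R <= e.
Proof.
move=> e0 b0; exists (Num.truncn (b / e)).+1 => // m /= mb.
have mR : 0 < m%:R :> R by rewrite ltr0n; exact: leq_trans mb.
rewrite ler_pdivrMr // mulrC -ler_pdivrMr //; apply: ltW.
by apply: lt_le_trans (truncnS_gt _) _; rewrite ler_nat.
Qed.

(** Empty when d does not divide i: then d cannot divide [g i], and there is nothing to centre. *)
Definition singleton_divisor d i := if (d %| i)%N then [:: d] else [::].

(** Up to time n the centring term [d ^- k] occurs [n %/ d] times; this supplies the additional
    factor 1/d in the limit. *)
Lemma average_dvd_cvg d : (0 < d)%N -> small (singleton_divisor d) ->
  average (fun i => (d %| g i)%N%:R) (m ^ 12) @[m --> \oo] --> ((d%:R ^+ k.+1)^-1 : R).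
Proof.
move=> d0 sm; apply/cvgrPdist_le => e e0.
(* One 1/m bounds the averaged divisor sum, the other the rounding in [n %/ d]. *)
have sm2 := near_inv e0 (ltr0Sn R 1).
near=> m.
have m0 : (0 < m)%N by near: m; exists 1%N.
have sm_m : `|\sum_(1 <= i < (m ^ 12).+1) \sum_(e <- singleton_divisor d i)
    ((e %| g i)%N%:R - (e%:R ^+ k)^-1)| <= m%:R ^+ 11 :> R by near: m.
have m2 : 2 / m%:R <= e by near: m.
have dR : 0 < d%:R :> R by rewrite ltr0n.
have mR : 1 <= m%:R :> R by rewrite ler1n.
set n := (m ^ 12)%N in sm_m *.
have nR : 0 < n%:R :> R by exact: natr_exp12_gt0.
pose b : R := (d%:R ^+ k)^-1.
have E : \sum_(1 <= i < n.+1) \sum_(e <- singleton_divisor d i)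
    ((e %| g i)%N%:R - (e%:R ^+ k)^-1) =
    \sum_(1 <= i < n.+1) (d %| g i)%N%:R - (n %/ d)%:R * b.
  have -> : (n %/ d)%:R * b = \sum_(1 <= i < n.+1) (d %| i)%N%:R * b.
    by rewrite (sum_multiples (fun=> b)) // big_const_nat subn1 iter_addr_0 mulr_natl.
  rewrite -sumrB; apply: eq_bigr => i _; rewrite /singleton_divisor.
  have [di|ndi] := boolP (d %| i)%N; first by rewrite big_seq1 mul1r.
  rewrite big_nil mul0r subr0 (_ : (d %| g i)%N = false) //.
  by apply: contraNF ndi => /dvdn_trans; apply.
have := small_average m0 sm_m; rewrite E mulrBr -/(average _ n).
have b01 : 0 < b <= 1.
  by rewrite invr_gt0 exprn_gt0 //= invf_le1 ?exprn_gt0 // exprn_ege1 // ler1n.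
have Db : (d%:R ^+ k.+1)^-1 = d%:R^-1 * b by rewrite exprS invfM.
have lo : d%:R^-1 - m%:R^-1 <= n%:R^-1 * (n %/ d)%:R :> R.
  rewrite -(ler_pM2l nR) mulrBr mulrA divff ?gt_eqF // mul1r.
  apply: (@le_trans _ _ (n%:R / d%:R - 1)).
    rewrite lerD2l lerN2 ler_pdivlMr ?ltr0n // mul1r ler_nat /n.
    by rewrite -{1}[m]expn1 leq_pexp2l.
  rewrite lerBlDr natr1 ler_pdivrMr // -natrM ler_nat.
  by rewrite ltnW // ltn_ceil.
have hi : n%:R^-1 * (n %/ d)%:R <= d%:R^-1 :> R.
  rewrite ler_pdivrMl // ler_pdivlMr // -natrM ler_nat; exact: leq_divM.
rewrite Db mulrA !ler_norml; move: lo hi b01 m2; rewrite mulrDl.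
set u := n%:R^-1 * _; set v := d%:R^-1; set w := m%:R^-1; set A := average _ _.
have w0 : 0 <= w by rewrite invr_ge0.
move=> lo hi /andP[b0 b1] m2 /andP[h1 h2].
have : 0 <= (v - u) * b <= w.
  apply/andP; split; first by apply: mulr_ge0; lra.
  by rewrite -[w]mulr1; apply: ler_pM; lra.
by rewrite mulrBl => /andP[h3 h4]; apply/andP; split; lra.
Unshelve. all: by end_near.
Qed.

(** Exchange the sums and drop primality: each p > M divides at most n/p of the times, which leaves
    n times the tail of the series of exponent k+1, at least 2. *)
Let sum_large_primes M n : (0 < M)%N ->
  \sum_(1 <= i < n.+1) \sum_(p <- large_primes M i) (p%:R ^+ k)^-1 <= n%:R / M%:R :> R.
Proof.
move=> M0; have b0 p : 0 <= (p%:R ^+ k)^-1 :> R by rewrite invr_ge0 exprn_ge0.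
apply: (@le_trans _ _ (\sum_(1 <= i < n.+1) \sum_(M.+1 <= p < n.+1)
    (p %| i)%N%:R * (p%:R ^+ k)^-1)).
  rewrite !big_nat; apply: ler_sum => i /andP[i0 ilt].
  rewrite [leRHS](bigID (fun p => prime p && (p %| i)%N)) /=; apply: ler_wpDr.
    by apply: sumr_ge0 => p _; rewrite mulr_ge0.
  rewrite -[leRHS]big_filter [leRHS](perm_big (large_primes M i)) /=.
    rewrite big_seq [leRHS]big_seq; apply: ler_sum => p.
    by rewrite mem_filter mem_primes => /and4P[_ _ _ ->]; rewrite mul1r.
  apply: uniq_perm; rewrite ?filter_uniq ?iota_uniq ?primes_uniq // => p.
  rewrite !mem_filter mem_primes mem_index_iota i0 ltnS /= andbC -!andbA.
  have [pp|] := boolP (prime p); rewrite ?andbF //=.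
  have [pi|] := boolP (p %| i)%N; rewrite ?andbF //= !andbT.
  rewrite andb_idr // => _; apply: leq_trans (dvdn_leq i0 pi) _.
  by rewrite -ltnS.
rewrite exchange_big /=.
apply: le_trans (_ : n%:R * \sum_(M.+1 <= p < n.+1) (p%:R ^+ k.+1)^-1 <= _); last first.
  by rewrite ler_wpM2l // sum_inv_exp_tail.
rewrite big_distrr !big_nat /=; apply: ler_sum => p /andP[Mp _].
have p0 : (0 < p)%N by apply: leq_ltn_trans Mp.
rewrite (sum_multiples (fun=> _)) // big_const_nat subn1 iter_addr_0 -[_ *+ (n %/ p)]mulr_natl.
rewrite exprS invfM mulrA ler_wpM2r // ler_pdivlMr ?ltr0n // -natrM ler_nat.
exact: leq_divM.
Qed.

Lemma average_large_primes M (e : R) : (0 < M)%N -> small (large_primes M) -> 0 < e ->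
  \forall m \near \oo,
    average (fun i => \sum_(p <- large_primes M i) (p %| g i)%N%:R) (m ^ 12) <= M%:R^-1 + e :> R.
Proof.
move=> M0 sm e0; have sm1 := near_inv e0 ltr01.
near=> m.
have m0 : (0 < m)%N by near: m; exists 1%N.
have sm_m : `|\sum_(1 <= i < (m ^ 12).+1) \sum_(e <- large_primes M i)
    ((e %| g i)%N%:R - (e%:R ^+ k)^-1)| <= m%:R ^+ 11 :> R by near: m.
have me : 1 / m%:R <= e by near: m.
have := small_average m0 sm_m.
under eq_bigr do rewrite sumrB.
rewrite sumrB mulrBr -/(average _ _) => /(le_trans (ler_norm _)).
have := sum_large_primes (m ^ 12) M0.
have n0 := natr_exp12_gt0 R m0; rewrite -ler_pdivrMl //.
lra.
Unshelve. all: by end_near.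
Qed.

End DivisorSumAverages.

(** * From twelfth powers to all times *)

(** Bernoulli's inequality, centred at 1. *)
Lemma ler_subX (R : realType) (x : R) n : 0 <= x <= 1 -> 1 - n%:R * (1 - x) <= x ^+ n.
Proof.
move=> /andP[x0 x1]; elim: n => [|n IH]; first by rewrite mul0r subr0 expr0.
have xn1 : x ^+ n <= 1 by rewrite exprn_ile1.
rewrite exprS -natr1; nra.
Qed.

(** Multiplied by n, the difference of averages is the sum over N < i <= n minus n - N times the
    earlier average; both lie between 0 and n - N. *)
Lemma average_interpolate (R : realType) (X : nat -> R) (N n : nat) :
  (forall i, 0 <= X i <= 1) -> (0 < N)%N -> (N <= n)%N ->
  `|average X n - average X N| <= 1 - N%:R / n%:R.
Proof.
move=> X01 N0 Nn; have n0 : (0 < n)%N by exact: leq_trans Nn.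
have NR : 0 < N%:R :> R by rewrite ltr0n.
have nR : 0 < n%:R :> R by rewrite ltr0n.
have NnR : N%:R <= n%:R :> R by rewrite ler_nat.
have Sbound a b : (a <= b)%N -> 0 <= \sum_(a.+1 <= i < b.+1) X i <= b%:R - a%:R.
  move=> ab; apply/andP; split; first by apply: sumr_ge0 => i _; have /andP[] := X01 i.
  rewrite -natrB // -subSS -[(_ - _)%:R]mulr1 mulr_natl -sumr_const_nat.
  by apply: ler_sum => i _; have /andP[] := X01 i.
have NS : (N.+1 <= n.+1)%N by [].
rewrite /average (big_cat_nat _ NS) //=.
have := Sbound 0%N N (leq0n _); have := Sbound N n Nn.
set S := \sum_(1 <= i < N.+1) X i; set S' := \sum_(_ <= i < _) X i.
rewrite subr0 => /andP[S'0 S'1] /andP[S0 S1].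
rewrite -(ler_pM2l nR) -{1}(gtr0_norm nR) -normrM.
have -> : n%:R * (n%:R^-1 * (S + S') - N%:R^-1 * S) = S' - (n%:R - N%:R) * (S / N%:R).
  by field; rewrite !gt_eqF.
have -> : n%:R * (1 - N%:R / n%:R) = n%:R - N%:R :> R by field; rewrite gt_eqF.
have : 0 <= S / N%:R <= 1 by rewrite ler_pdivrMr // mul1r S1 andbT mulr_ge0 // invr_ge0 ltW.
by move: (S / N%:R) => r /andP[r0 r1]; rewrite ler_norml; apply/andP; split; nra.
Qed.

Lemma cvg_average_pow12 (R : realType) (X : nat -> R) (l : R) :
  (forall i, 0 <= X i <= 1) ->
  average X (m ^ 12) @[m --> \oo] --> l -> average X n @[n --> \oo] --> l.
Proof.
move=> X01 /cvgrPdist_le Xl; apply/cvgrPdist_le => e e0.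
have e2 : 0 < e / 2 by rewrite divr_gt0.
have [M _ XM] := Xl _ e2.
(* For [m ^ 12 <= n < m.+1 ^ 12], Bernoulli bounds the interpolation error by 12/(m+1), and 24/e
   makes this at most e/2. *)
pose M' := maxn M.+1 (Num.truncn (24 / e)).+1.
exists (M' ^ 12)%N => // n /= Mn.
have M'0 : (0 < M')%N by rewrite /M' leq_max.
have exP : exists m, (m ^ 12 <= n)%N by exists M'.
have bnd m : (m ^ 12 <= n)%N -> (m <= n)%N.
  by apply: leq_trans; case: m => // m; rewrite -{1}[m.+1]expn1 leq_pexp2l.
have [m mn mmax] := ex_maxnP exP bnd.
have M'm : (M' <= m)%N by exact: mmax.
have m0 : (0 < m)%N by exact: leq_trans M'm.
have nm : (n < m.+1 ^ 12)%N by rewrite ltnNge; apply/negP => /mmax; rewrite ltnn.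
have mR : 0 < m%:R :> R by rewrite ltr0n.
have m1R : 0 < m.+1%:R :> R by rewrite ltr0n.
have n0 : (0 < n)%N by apply: leq_trans mn; rewrite expn_gt0 m0.
have nR : 0 < n%:R :> R by rewrite ltr0n.
have close : `|average X n - average X (m ^ 12)| <= e / 2.
  apply: le_trans (average_interpolate X01 _ mn) _; first by rewrite expn_gt0 m0.
  have le12 : (m%:R / m.+1%:R) ^+ 12 <= (m ^ 12)%:R / n%:R :> R.
    rewrite expr_div_n -!natrX ler_wpM2l // lef_pV2 ?posrE ?ltr0n ?expn_gt0 // ler_nat.
    exact: ltnW.
  have x01 : 0 <= (m%:R / m.+1%:R : R) <= 1.
    by apply/andP; split; [exact: divr_ge0 (ltW mR) (ltW m1R)|rewrite ler_pdivrMr // mul1r ler_nat].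
  have := ler_subX 12 x01.
  have -> : 1 - m%:R / m.+1%:R = m.+1%:R^-1 :> R by rewrite -natr1; field; rewrite natr1 gt_eqF.
  have : 12 * m.+1%:R^-1 <= e / 2.
    rewrite ler_pdivrMr // mulrC mulrA ler_pdivlMr // -ler_pdivrMr //.
    apply: (@le_trans _ _ (Num.truncn (24 / e)).+1%:R).
      by apply: le_trans (ltW (truncnS_gt _)); rewrite -natrM.
    rewrite ler_nat; apply: leq_trans (leqnSn _); apply: leq_trans M'm.
    by rewrite /M' leq_max leqnn orbT.
  move: le12; set y := _ ^+ 12; set r := _ / n%:R; set w := m.+1%:R^-1.
  clearbody y r w; lra.
have Mm : (M <= m)%N by apply: leq_trans M'm; rewrite /M' leq_max leqnSn.
move: (XM m Mm) close; rewrite !ler_norml; lra.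
Qed.

(** * The almost sure density of visible points *)

Lemma walk_gcd_dvd (T : Type) (k : nat) (W : nat -> T -> 'I_k) i x : (walk_gcd W i x %| i)%N.
Proof.
have {2}<- : (\sum_j walk_pos W i x j = i)%N.
  by rewrite -endpoint_walk_pos sum_endpoint big1 // size_mkseq.
apply: dvdn_sum => j _; exact: (biggcdn_inf j).
Qed.

Theorem theorem1p1 (R : realType) (k q : nat) (hk : (2 <= k)%N) (hq : (1 <= q)%N)
  (alpha : 'I_q -> 'I_k -> R) (halpha : forall t, is_type_vector (alpha t))
  (c : nat -> 'I_q)
  (d : measure_display) (T : measurableType d) (P : probability T R)
  (W : nat -> T -> 'I_k)
  (hWmeas : forall i (j : 'I_k), measurable [set x | W i x = j])
  (hWlaw : forall i (j : 'I_k), P [set x | W i x = j] = (alpha (c i) j)%:E)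
  (hWind : mutually_independent_discrete P W) :
  {ae P, forall x, mean_visible R W n x @[n --> \oo] --> (zeta R k)^-1}.
Proof.
case: k hk alpha halpha W hWmeas hWlaw hWind => [//|[//|k']] {}hk {}alpha {}halpha {}W.
move=> {}hWmeas {}hWlaw {}hWind.
have alpha_gt0 t j : 0 < alpha t j by have [/(_ j) /andP[]] := halpha t.
have alpha_sum1 t : \sum_j alpha t j = 1 by have [] := halpha t.
have small D := ae_divisor_sum_small alpha_gt0 alpha_sum1 hWmeas hWlaw hWind (D := D).
(* One null set must serve all divisors at once, by countability; [e.+1] ranges over the positive
   ones. *)
have ae_dvd : {ae P, forall x, forall e, \forall m \near \oo,
    `|\sum_(1 <= i < (m ^ 12).+1) \sum_(e <- singleton_divisor e.+1 i)
      ((e %| walk_gcd W i x)%N%:R - (e%:R ^+ k'.+1)^-1)| <= m%:R ^+ 11 :> R}.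
  apply: ae_foralln => e; apply: small => [i e'|i i0]; rewrite /singleton_divisor.
    by case: ifP => // ei; rewrite inE => /eqP ->.
  (* A one-element list gives 2 <= 2 i, with equality at i = 1: hence the factor 2 in the size
     condition. *)
  by case: ifP => _ //=; lia.
have ae_primes : {ae P, forall x, forall M, \forall m \near \oo,
    `|\sum_(1 <= i < (m ^ 12).+1) \sum_(e <- large_primes M i)
      ((e %| walk_gcd W i x)%N%:R - (e%:R ^+ k'.+1)^-1)| <= m%:R ^+ 11 :> R}.
  apply: ae_foralln => M; apply: small => [i p|i i0].
    by rewrite mem_filter mem_primes => /and4P[_ /prime_gt0 -> _ ->].
  apply: (@leq_trans (2 ^ size (primes i))).
    by rewrite leq_pexp2l // size_filter count_size.
  by apply: leq_trans (size_primes_le i0) _; lia.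
apply: filterS2 ae_dvd ae_primes => x xdvd xprimes.
apply: cvg_average_pow12 => [i|]; first by rewrite ler0n lern1 leq_b1.
apply: (density_coprime (g := fun i => walk_gcd W i x)) => //.
- by move=> i; exact: walk_gcd_dvd.
- by move=> [//|e] _; apply: average_dvd_cvg => // i; exact: walk_gcd_dvd.
- by move=> M e M0 e0; apply: (average_large_primes (k := k'.+1)).
Qed.
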